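(* Let $\Phi$ be an irreducible crystallographic root system of rank $n$ with Weyl group $W$ and affine Weyl group $\widetilde{W}=W\ltimes\mathbb{Z}\Phi^\vee$. For $w\in W$ and $J\subsetneq\{0,1,\dots,n\}$ let $F(w,J)=wA_J+\mathbb{Z}\Phi^\vee$, a cell of the reduced Steinberg torus $\Sigma'_T(\widetilde W)$. Then each cell of $\Sigma'_T(\widetilde W)$ has the form $F(w,J)$ for a unique pair $(w,J)$ with $w\in W$, $J\subsetneq\{0,1,\dots,n\}$ and $\widetilde{\mathrm{Des}}(w)\cap J=\varnothing$. Moreover, for each $w\in W$, the cells $F(w,J)$ with $\widetilde{\mathrm{Des}}(w)\cap J=\varnothing$ are precisely the cells in the closure of the maximal cell $F(w,\varnothing)$ that have in their closure the unique cell in the closure of $F(w,\varnothing)$ with color-set $\widetilde{\mathrm{Des}}(w)$, namely $F(w,\{0,\dots,n\}\setminus\widetilde{\mathrm{Des}}(w))$. Consequently, the reduced Steinberg torus is partitionable.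
   Context: Setting: $\Phi$ is an irreducible crystallographic root system in a real Euclidean space $V$ with inner product $\langle\cdot,\cdot\rangle$; $\alpha_1,\dots,\alpha_n$ is a fixed set of simple roots, assumed to span $V$; $W$ is the finite Weyl group; $\widetilde\alpha$ is the highest root and $\alpha_0:=-\widetilde\alpha$. Write $[0,n]=\{0,1,\dots,n\}$. $\mathbb{Z}\Phi^\vee$ is the lattice generated by the co-roots $\beta^\vee=2\beta/\langle\beta,\beta\rangle$, acting on $V$ by translations; $\widetilde W=W\ltimes\mathbb{Z}\Phi^\vee$. For $w\in W$, $\widetilde{\mathrm{Des}}(w):=\{j\in[0,n]:w\alpha_j<0\}$ (where $\beta<0$ means $\beta$ is a negative root). Affine Coxeter complex: the hyperplanes $\{\lambda\in V:\langle\lambda,\beta\rangle=k\}$ ($\beta\in\Phi$, $k\in\mathbb{Z}$) partition $V$ into the open cells of a simplicial complex $\Sigma(\widetilde W)$ (which also includes the empty face). For $J\subseteq[0,n]$ let $A_J$ be the set of all $\lambda\in V$ such that: $\langle\lambda,\alpha_j\rangle=0$ for $j\in J\setminus\{0\}$; $\langle\lambda,\alpha_j\rangle>0$ for $j\in\{1,\dots,n\}\setminus J$; and $\langle\lambda,\widetilde\alpha\rangle=1$ if $0\in J$, $\langle\lambda,\widetilde\alpha\rangle<1$ if $0\notin J$. Every cell has the form $\mu+wA_J$ with $\mu\in\mathbb{Z}\Phi^\vee$, $w\in W$, $J\subseteq[0,n]$ ($J=[0,n]$ giving the empty face). The vertices $\mu+wA_{[0,n]\setminus\{j\}}$ are given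 color $j$; then $\mu+wA_J$ has vertex color-set $[0,n]\setminus J$, without repetition. Steinberg torus: the quotient cell complex $\Sigma_T(\widetilde W)=\Sigma(\widetilde W)/\mathbb{Z}\Phi^\vee$ (a finite Boolean cell complex, whose cells inherit color-sets). The reduced Steinberg torus $\Sigma'_T(\widetilde W)$ is obtained from it by deleting the empty cell of dimension $-1$. Such a (relative) complex is partitionable if the set of its cells, ordered by inclusion of closures, is a disjoint union of intervals $[G_F,F]$, one for each maximal cell $F$, with $F$ as the top element. *)

(* Defs.v *)
From mathcomp Require Import all_boot all_order all_algebra.
From mathcomp Require Import sesquilinear finmap.
From mathcomp Require Import all_classical all_reals all_analysis.
Import Order.TTheory GRing.Theory Num.Theory.
Import numFieldNormedType.Exports.

Set Implicit Arguments.
Unset Strict Implicit.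
Unset Printing Implicit Defensive.

Local Open Scope classical_set_scope.
Local Open Scope ring_scope.

Section RootSystems.

Context {R : realType} {V : normedModType R} (ip : {dot V for @idfun R}).

Definition reflection (b x : V) : V := x - (2 * ip x b / ip b b) *: b.

Definition coroot (b : V) : V := (2 / ip b b) *: b.

(* Root systems are reduced. *)
Definition crystallographic_root_system (Phi : {fset V}) : Prop :=
  [/\ 0 \notin Phi,
      forall v : V, exists c : V -> R, v = \sum_(b <- Phi) c b *: b,
      forall b c, b \in Phi -> c *: b \in Phi -> c = 1 \/ c = -1,
      forall b g, b \in Phi -> g \in Phi -> reflection b g \in Phi &
      forall b g, b \in Phi -> g \in Phi -> ip g (coroot b) \is a Num.int].

Definition irreducible_root_system (Phi : {fset V}) : Prop :=
  Phi != fset0 /\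
  forall A B : {fset V}, Phi = (A `|` B)%fset ->
    (forall a b, a \in A -> b \in B -> ip a b = 0) ->
    A = fset0 \/ B = fset0.

Section SimpleRoots.

Context {n : nat} (Phi : {fset V}) (alpha : 'I_n -> V).

Definition nonneg_comb (x : V) : Prop :=
  exists c : 'I_n -> nat, x = \sum_i alpha i *+ c i.

Definition simple_roots : Prop :=
  [/\ forall i, alpha i \in Phi,
      forall c : 'I_n -> R, \sum_i c i *: alpha i = 0 -> forall i, c i = 0,
      forall v : V, exists c : 'I_n -> R, v = \sum_i c i *: alpha i &
      forall b, b \in Phi -> nonneg_comb b \/ nonneg_comb (- b)].

Definition negative_root (b : V) : Prop := b \in Phi /\ nonneg_comb (- b).

Definition highest_root (theta : V) : Prop :=
  theta \in Phi /\ forall b, b \in Phi -> nonneg_comb (theta - b).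

End SimpleRoots.

(* The elements of W are represented by the maps V -> V; reflections being
   involutions, closure under inverses is automatic. *)
Inductive weyl_group (Phi : {fset V}) : set (V -> V) :=
| weyl_id : weyl_group Phi id
| weyl_refl b w : b \in Phi -> weyl_group Phi w ->
    weyl_group Phi (reflection b \o w).

Definition coroot_lattice (Phi : {fset V}) : set V :=
  [set \sum_(b <- Phi) coroot b *~ c b | c in [set: V -> int]].

(* Cells of the affine Coxeter complex: the empty face, and the classes of
   points lying on the same side of (or on) every hyperplane <., b> = k. *)
Definition same_side (Phi : {fset V}) (x y : V) : Prop :=
  forall (b : V) (k : int), b \in Phi ->
    Num.sg (ip x b - k%:~R) = Num.sg (ip y b - k%:~R).

Definition affine_cell (Phi : {fset V}) (C : set V) : Prop :=
  C = set0 \/ exists x, C = [set y | same_side Phi x y].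

(* A subset of the torus V / L, with L the coroot lattice, is represented by
   its preimage in V, an L-stable subset of V; the image in V / L of a cell C
   is thus represented by C + L.  As V -> V / L is open and continuous, taking
   closures commutes with taking preimages, so that the closure in V of an
   L-stable set represents the closure in V / L. *)
Definition torus_image (Phi : {fset V}) (C : set V) : set V :=
  [set x + m | x in C & m in coroot_lattice Phi].

Definition steinberg_torus (Phi : {fset V}) : set (set V) :=
  [set torus_image Phi C | C in affine_cell Phi].

Definition reduced_steinberg_torus (Phi : {fset V}) : set (set V) :=
  steinberg_torus Phi `\ set0.

Definition cell_le (X Y : set V) : Prop := closure X `<=` closure Y.

Section Faces.

Context {n : nat} (Phi : {fset V}) (alpha : 'I_n -> V) (theta : V).

(* Indices 0, 1, .., n: ord0 stands for 0 and lift ord0 i for the index of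
   the simple root alpha i. *)
Definition ext_simple_root (j : 'I_n.+1) : V :=
  if unlift ord0 j is Some i then alpha i else - theta.

Definition affine_descents (w : V -> V) : set 'I_n.+1 :=
  [set j | negative_root Phi alpha (w (ext_simple_root j))].

Definition alcove_face (J : set 'I_n.+1) : set V :=
  [set x | [/\ forall i, J (lift ord0 i) -> ip x (alpha i) = 0,
               forall i, ~ J (lift ord0 i) -> 0 < ip x (alpha i),
               J ord0 -> ip x theta = 1 &
               ~ J ord0 -> ip x theta < 1]].

Definition torus_cell (w : V -> V) (J : set 'I_n.+1) : set V :=
  torus_image Phi (w @` alcove_face J).

(* The set of colors of the vertices of X, where the vertices of color j are
   the translates of w A_J with w in W and J the complement of {j}. *)
Definition color_set (X : set V) : set 'I_n.+1 :=
  [set j | exists2 w, weyl_group Phi w & cell_le (torus_cell w (~` [set j])) X].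

End Faces.

End RootSystems.

Section Partitionability.

Context {T : Type} (cell : set T) (le : T -> T -> Prop).

Definition maximal_cell (F : T) : Prop :=
  cell F /\ forall X, cell X -> le F X -> X = F.

(* The cells are the disjoint union of the intervals [G F, F], for F maximal. *)
Definition partitionable : Prop :=
  exists G : T -> T,
    (forall F, maximal_cell F -> cell (G F) /\ le (G F) F) /\
    (forall X, cell X -> exists! F, [/\ maximal_cell F, le (G F) X & le X F]).

End Partitionability.

(* Main.v *)
(* Let p be a point with <p, alpha_i> > 0 for all i.  Given z in V, the points
   z + e p with e > 0 small lie in a single alcove mu + w A_0; this w, together
   with the set J of the walls containing w^-1 (z - mu), gives the cell F(w, J)
   of z, and <p, w alpha_j> > 0 for j in J says that J contains no descent of w.
   Conversely, if J contains no descent of w and z lies in F(w, J), then z + e p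
   lies in a translate of w A_0.  Since the affine Weyl group acts simply
   transitively on the alcoves, (w, J) is determined by the cell.
   Since the closed alcove is a strict fundamental domain, F(w, J) has colour
   set the complement of J, and the faces of F(w, 0) are the cells F(w, K); the
   cells F(w, J) without descents in J therefore form the interval from
   F(w, complement of Des w) to F(w, 0).
   Both facts on the alcoves rest on the following: an affine root positive on
   the fundamental alcove is a nonnegative combination of the affine functions
   <., alpha_i> and 1 - <., theta> cutting out that alcove.
   Notation: A_0 and F(w, 0) stand for the case J empty. *)

Require Import Defs.
From mathcomp Require Import all_boot all_order all_algebra.
From mathcomp Require Import sesquilinear finmap.
From mathcomp Require Import all_classical all_reals all_analysis.
From mathcomp Require Import zify ring lra.
Import Order.TTheory GRing.Theory Num.Theory.
Import numFieldNormedType.Exports.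

Local Open Scope classical_set_scope.
Local Open Scope ring_scope.

Set Implicit Arguments.
Unset Strict Implicit.
Unset Printing Implicit Defensive.

Lemma seq_lower_bound (R : realType) (T : eqType) (s : seq T) (f : T -> R) :
  (forall i, i \in s -> 0 < f i) ->
  exists e, 0 < e /\ forall i, i \in s -> e <= f i.
Proof.
elim: s => [|i s IH] f0; first by exists 1; split.
have [|e [e0 eP]] := IH; first by move=> l ls; rewrite f0// inE ls orbT.
exists (Num.min (f i) e); split; first by rewrite lt_min e0 f0// inE eqxx.
by move=> l; rewrite inE ge_min => /orP[/eqP->|/eP->]; rewrite ?lexx ?orbT.
Qed.

(** * Affine reflections *)

Section AffineReflections.

Context {R : realType} {V : normedModType R} (ip : {dot V for @idfun R}).

Lemma ipC x y : ip x y = ip y x.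
Proof. by rewrite hermC expr0 mul1r. Qed.

Lemma ipDl x y z : ip (x + y) z = ip x z + ip y z.
Proof. exact: linearDl. Qed.

Lemma ipNl x z : ip (- x) z = - ip x z.
Proof. exact: linearNl. Qed.

Lemma ipZl c x z : ip (c *: x) z = c * ip x z.
Proof. exact: linearZl_LR. Qed.

Lemma ipDr x y z : ip z (x + y) = ip z x + ip z y.
Proof. exact: linearDr. Qed.

Lemma ipNr x z : ip z (- x) = - ip z x.
Proof. exact: linearNr. Qed.

Lemma ipZr c x z : ip z (c *: x) = c * ip z x.
Proof. exact: linearZr_LR. Qed.

Definition ipE := (ipDl, ipNl, ipZl, ipDr, ipNr, ipZr).

Lemma ip0l z : ip 0 z = 0.
Proof. exact: linear0l. Qed.

Lemma ip_gt0 x : x != 0 -> 0 < ip x x.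
Proof. exact: neq0_dnorm_gt0. Qed.

Lemma ip_eq0 x : ip x x = 0 -> x = 0.
Proof.
move=> x0; apply/eqP; apply: contra_eqT x0 => /ip_gt0; exact: lt0r_neq0.
Qed.

Lemma ip_neq0 x : x != 0 -> ip x x != 0.
Proof. by move/ip_gt0/lt0r_neq0. Qed.

Lemma ip_ge0 x : 0 <= ip x x.
Proof.
by have [->|/ip_gt0/ltW//] := eqVneq x 0; rewrite ip0l.
Qed.

(** Expand the square norm of [ip y y *: x - ip x y *: y], a multiple of the component of x
    orthogonal to y that avoids a division. *)
Lemma cauchy_schwarz x y : ip x y ^+ 2 <= ip x x * ip y y.
Proof.
have [->|y0] := eqVneq y 0; first by rewrite ipC !ip0l mulr0 expr0n.
have yy := ip_gt0 y0.
have := ip_ge0 (ip y y *: x - ip x y *: y); rewrite !ipE (ipC y x) => h.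
have : 0 <= ip y y * (ip x x * ip y y - ip x y ^+ 2) by move: h; nra.
by rewrite pmulr_rge0 // subr_ge0.
Qed.

(** The zero set is <x, b> = -k: the level has the opposite sign to the one in [same_side]. *)
Definition affine_root (b : V) (k : int) (x : V) : R := ip x b + k%:~R.

Definition affine_reflection (b : V) (k : int) (x : V) : V :=
  x - affine_root b k x *: coroot ip b.

Lemma ip_coroot x b : ip x (coroot ip b) = 2 * ip x b / ip b b.
Proof. by rewrite /coroot ipZr mulrAC. Qed.

Lemma reflectionE b x : reflection ip b x = x - ip x b *: coroot ip b.
Proof.
by rewrite /reflection /coroot scalerA mulrCA mulrA.
Qed.

Lemma affine_reflectionE b k x :
  affine_reflection b k x = reflection ip b x - k%:~R *: coroot ip b.
Proof.
by rewrite reflectionE /affine_reflection /affine_root scalerDl opprD addrA.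
Qed.

Lemma affine_reflection0 b x : affine_reflection b 0 x = reflection ip b x.
Proof. by rewrite affine_reflectionE scale0r subr0. Qed.

Lemma reflectionD b x y :
  reflection ip b (x + y) = reflection ip b x + reflection ip b y.
Proof. by rewrite !reflectionE ipDl scalerDl opprD addrACA. Qed.

Lemma reflectionZ b c x : reflection ip b (c *: x) = c *: reflection ip b x.
Proof. by rewrite !reflectionE ipZl scalerBr !scalerA. Qed.

Lemma ip_reflection b x y : b != 0 ->
  ip (reflection ip b x) (reflection ip b y) = ip x y.
Proof.
by move=> /ip_neq0 b0; rewrite /reflection !ipE (ipC b y); field.
Qed.

Lemma reflectionK b : b != 0 -> involutive (reflection ip b).
Proof.
move=> /ip_neq0 b0 x; rewrite /reflection !ipE -addrA -opprD -scalerDl.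
rewrite [X in _ - X *: _](_ : _ = 0) ?scale0r ?subr0//; by field.
Qed.

Lemma reflection_root b : b != 0 -> reflection ip b b = - b.
Proof.
move=> /ip_neq0 b0; rewrite /reflection mulfK// scaler_nat mulr2n.
by rewrite opprD addrA subrr sub0r.
Qed.

Lemma affine_root_reflection b k x : b != 0 ->
  affine_root b k (affine_reflection b k x) = - affine_root b k x.
Proof.
move=> /ip_neq0 b0; rewrite /affine_reflection /affine_root /coroot !ipE.
by field.
Qed.

Lemma affine_reflectionK b k : b != 0 -> involutive (affine_reflection b k).
Proof.
move=> b0 x; rewrite {1}/affine_reflection affine_root_reflection//.
by rewrite /affine_reflection scaleNr opprK subrK.
Qed.

Lemma coroot_reflection b g : g != 0 ->
  coroot ip (reflection ip g b) = reflection ip g (coroot ip b).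
Proof. by move=> g0; rewrite /coroot ip_reflection// reflectionZ. Qed.

Lemma affine_reflectionN b k :
  affine_reflection (- b) (- k) =1 affine_reflection b k.
Proof.
move=> x; rewrite /affine_reflection /affine_root /coroot !ipE opprK rmorphN/=.
by rewrite -opprD scaleNr scalerN scalerN opprK.
Qed.

Lemma affine_rootN b k x : affine_root (- b) (- k) x = - affine_root b k x.
Proof. by rewrite /affine_root ipNr rmorphN/= opprD. Qed.

(* If two roots define proportional affine functions, they have the same
   reflection, so that reducedness of the root system is not an issue. *)
Lemma affine_reflection_proportional b b' k k' c : c != 0 -> b' != 0 ->
  (forall x, affine_root b k x = c * affine_root b' k' x) ->
  affine_reflection b k =1 affine_reflection b' k'.
Proof.
move=> c0 b'0 H; have Hk : k%:~R = c * k'%:~R.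
  by have := H 0; rewrite /affine_root !ip0l !add0r.
have Hb : b = c *: b'.
  apply/eqP; rewrite -subr_eq0; apply/eqP/ip_eq0; rewrite ipDr ipNr ipZr.
  have := H (b - c *: b'); rewrite /affine_root Hk mulrDr => /addIr ->.
  by rewrite subrr.
move=> x; rewrite /affine_reflection H; congr (_ - _).
rewrite /coroot Hb !ipE !scalerA; congr (_ *: _).
by have h := ip_neq0 b'0; field; rewrite c0 h.
Qed.

(** Integrality of <b, g^vee> keeps the new level an integer, so affine reflections carry affine
    roots to affine roots. *)
Lemma affine_root_comp b k g l m : ip b (coroot ip g) = m%:~R -> g != 0 ->
  affine_root b k \o affine_reflection g l =1
  affine_root (reflection ip g b) (k - l * m).
Proof.
move=> bg g0 x; rewrite /= affine_reflectionE /affine_root rmorphB rmorphM/=.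
rewrite -(ip_reflection x _ g0) reflectionK//.
rewrite [ip (_ - _) b]ipDl ipNl ipZl [ip (coroot _ _) _]ipC bg.
by rewrite -addrA [- _ + _]addrC.
Qed.

Lemma affine_reflection_conj b k g l m :
  ip b (coroot ip g) = m%:~R -> g != 0 ->
  affine_reflection b k \o affine_reflection g l =1
  affine_reflection g l \o affine_reflection (reflection ip g b) (k - l * m).
Proof.
move=> bg g0 x; rewrite /= [RHS]affine_reflectionE.
rewrite [in RHS]/affine_reflection.
rewrite -(affine_root_comp _ _ bg g0)/= reflectionD -scaleNr reflectionZ.
rewrite coroot_reflection// reflectionK// addrAC -affine_reflectionE.
by rewrite scaleNr.
Qed.

End AffineReflections.
Section Alcoves.

Context {R : realType} {V : normedModType R} (ip : {dot V for @idfun R})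
  (n : nat) (Phi : {fset V}) (alpha : 'I_n -> V) (theta : V)
  (Phi_root : crystallographic_root_system ip Phi)
  (alpha_simple : simple_roots Phi alpha)
  (theta_highest : highest_root Phi alpha theta)
  (ip_norm : forall x : V, ip x x = `|x| ^+ 2).

(** * Walls of the fundamental alcove *)

Lemma root_neq0 b : b \in Phi -> b != 0.
Proof. by case: Phi_root => Phi0 _ _ _ _; apply: contraTneq => ->. Qed.

Lemma root_reflection b g : b \in Phi -> g \in Phi -> reflection ip b g \in Phi.
Proof. by case: Phi_root => _ _ _ h _; apply: h. Qed.

Lemma rootN b : b \in Phi -> - b \in Phi.
Proof.
by move=> bP; rewrite -(reflection_root ip (root_neq0 bP)) root_reflection.
Qed.

Lemma root_int b g : b \in Phi -> g \in Phi ->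
  exists m : int, ip g (coroot ip b) = m%:~R.
Proof. by case: Phi_root => _ _ _ _ h bP gP; apply/intrP/h. Qed.

Lemma simple_root_in i : alpha i \in Phi.
Proof. by case: alpha_simple. Qed.

Lemma theta_in : theta \in Phi.
Proof. by case: theta_highest. Qed.

Lemma simple_coef_uniq (c d : 'I_n -> R) :
  \sum_i c i *: alpha i = \sum_i d i *: alpha i -> c =1 d.
Proof.
case: alpha_simple => _ free _ _ /eqP; rewrite -subr_eq0 -sumrB => /eqP cd i.
apply/eqP; rewrite -subr_eq0; apply/eqP.
by apply: (free (fun i => c i - d i)); under eq_bigr do rewrite scalerBl.
Qed.

Lemma nonneg_combE (c : 'I_n -> nat) :
  \sum_i alpha i *+ c i = \sum_i (c i)%:R *: alpha i.
Proof. by apply: eq_bigr => i _; rewrite scaler_nat. Qed.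

Lemma ip_suml (c : 'I_n -> R) x :
  ip x (\sum_i c i *: alpha i) = \sum_i c i * ip x (alpha i).
Proof.
rewrite linear_sumr; apply: eq_bigr => i _; exact: ipZr.
Qed.

(** Coefficients on the simple roots are unique, so the nonnegative combination [theta - b] compares
    them one by one; b = alpha i gives the bound 1. *)
Lemma theta_coef : exists t : 'I_n -> R,
  [/\ theta = \sum_i t i *: alpha i, forall i, 1 <= t i &
      forall b (c : 'I_n -> R), b \in Phi -> b = \sum_i c i *: alpha i ->
        forall i, c i <= t i].
Proof.
case: alpha_simple => _ _ /(_ theta) [t tE] _.
have le_t b (c : 'I_n -> R) : b \in Phi -> b = \sum_i c i *: alpha i ->
    forall i, c i <= t i.
  move=> bP bE i; case: theta_highest => _ /(_ b bP) [d].
  rewrite nonneg_combE => /eqP; rewrite subr_eq => /eqP dE.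
  have /(_ i) -> : t =1 (fun i => (d i)%:R + c i).
    apply: simple_coef_uniq; rewrite -tE dE {1}bE -big_split/=.
    by apply: eq_bigr => j _; rewrite scalerDl.
  by rewrite lerDr ler0n.
exists t; split=> // i.
apply: (le_trans _ (le_t (alpha i) (fun j => (j == i)%:R) _ _ i)).
- by rewrite eqxx.
- exact: simple_root_in.
- rewrite (bigD1 i)//= eqxx scale1r big1 ?addr0// => j /negPf ->.
  by rewrite scale0r.
Qed.

Lemma pos_or_neg_coef b : b \in Phi -> exists c : 'I_n -> R,
  b = \sum_i c i *: alpha i /\ ((forall i, 0 <= c i) \/ (forall i, c i <= 0)).
Proof.
case: alpha_simple => _ _ _ h /h [] [c]; rewrite nonneg_combE => bE.
  by exists (fun i => (c i)%:R); split=> //; left.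
exists (fun i => - (c i)%:R); split; last by right=> i; rewrite oppr_le0.
rewrite -[LHS]opprK bE -sumrN.
by apply: eq_bigr => i _; rewrite scaleNr.
Qed.

Lemma ext_simple_root_in j : ext_simple_root alpha theta j \in Phi.
Proof.
rewrite /ext_simple_root; case: unliftP => [i _|_].
  exact: simple_root_in.
exact: rootN theta_in.
Qed.

Lemma ext_simple_root_neq0 j : ext_simple_root alpha theta j != 0.
Proof. exact: root_neq0 (ext_simple_root_in j). Qed.

Definition wall_level (j : 'I_n.+1) : int := (j == ord0)%:R.

(* The barycentric coordinates of the fundamental alcove, up to positive
   factors: <x, alpha_j> for j <> 0, and 1 - <x, theta> for j = 0. *)
Definition wall (j : 'I_n.+1) : V -> R :=
  affine_root ip (ext_simple_root alpha theta j) (wall_level j).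

Definition wall_reflection (j : 'I_n.+1) : V -> V :=
  affine_reflection ip (ext_simple_root alpha theta j) (wall_level j).

Lemma wall0 x : wall ord0 x = 1 - ip x theta.
Proof.
by rewrite /wall /affine_root /ext_simple_root unlift_none ipNr addrC.
Qed.

Lemma wall_lift i x : wall (lift ord0 i) x = ip x (alpha i).
Proof. by rewrite /wall /affine_root /ext_simple_root liftK addr0. Qed.

Lemma alcove_faceP (J : set 'I_n.+1) x : alcove_face ip alpha theta J x <->
  forall j, (J j -> wall j x = 0) /\ (~ J j -> 0 < wall j x).
Proof.
split=> [[h1 h2 h3 h4] j|h].
  have [i ->|->] := unliftP ord0 j; first by rewrite wall_lift; split; auto.
  rewrite wall0; split=> [/h3->|/h4]; first by rewrite subrr.
  by rewrite subr_gt0.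
split=> [i Ji|i Ji|J0|J0].
- by rewrite -wall_lift; apply: (h _).1.
- by rewrite -wall_lift; apply: (h _).2.
- by have := (h ord0).1 J0; rewrite wall0 => /eqP; rewrite subr_eq0 => /eqP <-.
- by have := (h ord0).2 J0; rewrite wall0 subr_gt0.
Qed.

(** With t the coefficients of theta, (1 - <x, theta>) + sum t_i <x, alpha_i> is constantly 1.
    Constants thus become combinations of the walls. *)
Lemma wall_partition_of_unity : exists m : 'I_n.+1 -> R,
  (forall j, 0 < m j) /\ forall x, \sum_j m j * wall j x = 1.
Proof.
have [t [tE t1 _]] := theta_coef.
exists (fun j => if unlift ord0 j is Some i then t i else 1); split.
  move=> j; case: unliftP => [i _|_]//.
  by apply: lt_le_trans (t1 i).
move=> x; rewrite big_ord_recl unlift_none mul1r wall0 tE ip_suml.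
under [X in _ + X]eq_bigr do rewrite liftK wall_lift.
by rewrite subrK.
Qed.

(** For k >= 0, add k times the partition of unity to the expansion of b. For k < 0, integrality
    gives k <= -1, and -(b + k) = (theta - b) + (1 - theta) + (-1 - k) is a sum of nonnegative
    combinations, as the coefficients of theta dominate. *)
Lemma affine_root_wall_pos b k (c : 'I_n -> R) : b \in Phi ->
  b = \sum_i c i *: alpha i -> (forall i, 0 <= c i) ->
  exists d : 'I_n.+1 -> R,
    ((forall j, 0 <= d j) \/ (forall j, d j <= 0)) /\
    forall x, affine_root ip b k x = \sum_j d j * wall j x.
Proof.
move=> bP bE c0; have [t [tE t1 tmax]] := theta_coef.
have ct i : c i <= t i by exact: tmax bE i.
have [m [m0 mE]] := wall_partition_of_unity.
have bw x : ip x b = \sum_i c i * wall (lift ord0 i) x.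
  by rewrite bE ip_suml; apply: eq_bigr => i _; rewrite wall_lift.
have tw x : ip x theta = \sum_i t i * wall (lift ord0 i) x.
  by rewrite tE ip_suml; apply: eq_bigr => i _; rewrite wall_lift.
have [k0|k0] := leP 0 k.
  exists (fun j => (if unlift ord0 j is Some i then c i else 0) + k%:~R * m j).
  split=> [|x]; first left=> j.
    rewrite addr_ge0//; first by case: unliftP.
    by rewrite mulr_ge0 ?ler0z// ltW.
  under eq_bigr do rewrite mulrDl -mulrA.
  rewrite big_split/= -mulr_sumr mE mulr1 big_ord_recl unlift_none mul0r add0r.
  by under eq_bigr do rewrite liftK; rewrite -bw.
have k1 : 0 <= - 1 - k by lia.
exists (fun j => - ((if unlift ord0 j is Some i then t i - c i else 1)
                     + (- 1 - k)%:~R * m j)).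
split=> [|x]; first right=> j.
  rewrite oppr_le0 addr_ge0//; last by rewrite mulr_ge0 ?ler0z// ltW.
  by case: unliftP => // i _; rewrite subr_ge0.
under eq_bigr do rewrite mulNr mulrDl -mulrA.
rewrite sumrN big_split/= -mulr_sumr mE mulr1 big_ord_recl unlift_none mul1r.
under eq_bigr do rewrite liftK mulrBl.
rewrite sumrB -tw -bw wall0 /affine_root rmorphB/= rmorphN1; ring.
Qed.

(* Hence no hyperplane of the affine arrangement cuts the alcove. *)
Lemma affine_root_wall b k : b \in Phi ->
  exists c : 'I_n.+1 -> R,
    ((forall j, 0 <= c j) \/ (forall j, c j <= 0)) /\
    forall x, affine_root ip b k x = \sum_j c j * wall j x.
Proof.
move=> bP; have [c [bE [c0|c0]]] := pos_or_neg_coef bP.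
  exact: affine_root_wall_pos bE c0.
have bE' : - b = \sum_i (- c i) *: alpha i.
  by rewrite bE -sumrN; apply: eq_bigr => i _; rewrite scaleNr.
have [|d [d0 dE]] := affine_root_wall_pos (- k) (rootN bP) bE'.
  by move=> i; rewrite oppr_ge0.
exists (fun j => - d j); split=> [|x].
  by case: d0 => d0; [right|left] => j; rewrite (oppr_le0, oppr_ge0).
rewrite -[LHS]opprK -affine_rootN dE -sumrN.
by apply: eq_bigr => j _; rewrite mulNr.
Qed.

(** * Points with prescribed wall values *)

Lemma dual_vector (v : 'I_n -> R) : exists x, forall i, ip x (alpha i) = v i.
Proof.
pose G := \matrix_(i, j) ip (alpha i) (alpha j).
have rowE (u : 'rV_n) j : (u *m G) 0 j = ip (\sum_i u 0 i *: alpha i) (alpha j).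
  rewrite ipC ip_suml mxE; apply: eq_bigr => i _.
  by rewrite mxE ipC.
(* A kernel vector of the Gram matrix gives a combination of simple roots orthogonal to all of them,
   hence to itself. *)
have Gu : G \in unitmx.
  rewrite -row_free_unit; apply: inj_row_free => u uG.
  have x0 : \sum_i u 0 i *: alpha i = 0.
    apply: (@ip_eq0 _ _ ip); rewrite ip_suml big1// => i _.
    by rewrite -rowE uG mxE mulr0.
  apply/rowP => i; rewrite mxE.
  by case: alpha_simple => _ /(_ (fun i => u 0 i) x0).
pose r := \row_i v i; exists (\sum_i (r *m invmx G) 0 i *: alpha i) => i.
by rewrite -rowE mulmxKV// mxE.
Qed.

(** The partition of unity fixes the weighted sum of the wall values, whence the factor s = 1 / S;
    it also forces the value at index 0 once the others are prescribed. *)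
Lemma wall_prescribed (u : 'I_n.+1 -> R) :
  (forall j, 0 <= u j) -> (exists j, 0 < u j) ->
  exists x s, 0 < s /\ forall j, wall j x = s * u j.
Proof.
move=> u0 [j uj]; have [m [m0 mE]] := wall_partition_of_unity.
pose S := \sum_j m j * u j.
have S0 : 0 < S.
  rewrite /S (bigD1 j)//= ltr_pwDl ?mulr_gt0// sumr_ge0// => i _.
  by rewrite mulr_ge0// ltW.
have [x xE] := dual_vector (fun i => S^-1 * u (lift ord0 i)).
exists x, S^-1; rewrite invr_gt0; split=> // i.
have [i' ->|->] := unliftP ord0 i; first by rewrite wall_lift.
apply: (mulfI (lt0r_neq0 (m0 ord0))).
pose B := \sum_(l < n) m (lift ord0 l) * u (lift ord0 l).
have SE : S = m ord0 * u ord0 + B by rewrite /S big_ord_recl.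
rewrite mulrCA; apply: (addIr (S^-1 * B)); rewrite -mulrDr -SE.
rewrite mulVf ?lt0r_neq0// -(mE x) big_ord_recl /B mulr_sumr; congr (_ + _).
by apply: eq_bigr => l _; rewrite wall_lift xE mulrCA.
Qed.

Lemma alcove_face_neq0 (J : set 'I_n.+1) : J `<` [set: 'I_n.+1] ->
  exists x, alcove_face ip alpha theta J x.
Proof.
rewrite properEneq => -[/eqP JT _].
have [j Jj] : exists j, ~ J j.
  by apply: contrapT => /forallNP h; apply: JT; apply/seteqP; split=> // i _;
    apply: contrapT.
have [||x [s [s0 xE]]] := @wall_prescribed (fun j => (~~ `[< J j >])%:R).
- by move=> i; rewrite ler0n.
- by exists j; rewrite asboolF.
exists x; apply/alcove_faceP => i; rewrite xE; split=> Ji.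
  by rewrite asboolT// mulr0.
by rewrite asboolF// mulr1.
Qed.

(** * Signs of affine roots on the alcove and its faces *)

Definition alcove x := forall j, 0 < wall j x.

Definition closed_alcove x := forall j, 0 <= wall j x.

Lemma alcoveW x : alcove x -> closed_alcove x.
Proof. by move=> h j; apply: ltW. Qed.

Lemma alcoveP x : alcove_face ip alpha theta set0 x <-> alcove x.
Proof.
rewrite alcove_faceP; split=> [h j|h j]; last by split.
by apply: (h j).2.
Qed.

Lemma alcove_neq0 : exists x, alcove x.
Proof.
have [|x /alcoveP] := @alcove_face_neq0 set0; last by exists x.
by rewrite properEneq; split=> //; apply/eqP => /seteqP[_ /(_ ord0)]; apply.
Qed.

Lemma rank_gt0 : (0 < n)%N.
Proof.
case: alpha_simple => _ _ /(_ theta) [c cE] _.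
case: (posnP n) => // n0; have /negP[] := root_neq0 theta_in.
by rewrite cE big1// => i _; exfalso; have := ltn_ord i; lia.
Qed.

Lemma facet_neq0 j :
  exists x, wall j x = 0 /\ forall i, i != j -> 0 < wall i x.
Proof.
have [|x /alcove_faceP h] := @alcove_face_neq0 [set j].
  rewrite properEneq; split=> //; apply/eqP => /seteqP[_ h].
  have := h (lift j (Ordinal rank_gt0)) I => /= /eqP.
  by rewrite eq_sym (negPf (neq_lift _ _)).
exists x; split; first exact: (h j).1.
by move=> i ij; apply: (h i).2 => /= /eqP; apply/negP.
Qed.

Lemma affine_root_sign b k : b \in Phi ->
  (forall x, closed_alcove x -> 0 <= affine_root ip b k x) \/
  (forall x, closed_alcove x -> affine_root ip b k x <= 0).
Proof.
move=> /(affine_root_wall k) [c [[c0|c0] cE]]; [left|right] => x x0.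
  by rewrite cE sumr_ge0// => j _; rewrite mulr_ge0.
by rewrite cE sumr_le0// => j _; rewrite mulr_le0_ge0.
Qed.

(** A nonnegative combination of the walls vanishes on A_J if its coefficients off J are all zero
    and is positive there otherwise, a dichotomy that does not involve the point. *)
Lemma affine_root_sg b k J x y : b \in Phi ->
  alcove_face ip alpha theta J x -> alcove_face ip alpha theta J y ->
  Num.sg (affine_root ip b k x) = Num.sg (affine_root ip b k y).
Proof.
have sgN (a : R) : Num.sg a = - Num.sg (- a) by rewrite sgrN opprK.
have sum_sg (c : 'I_n.+1 -> R) u v : (forall j, 0 <= c j) ->
    alcove_face ip alpha theta J u -> alcove_face ip alpha theta J v ->
    Num.sg (\sum_j c j * wall j u) = Num.sg (\sum_j c j * wall j v).
  move=> c0 /alcove_faceP uJ /alcove_faceP vJ.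
  have ge0 w j : (forall j, (J j -> wall j w = 0) /\ (~ J j -> 0 < wall j w)) ->
      0 <= c j * wall j w.
    move=> wJ; rewrite mulr_ge0//.
    by have [/(wJ j).1->//|/(wJ j).2/ltW] := pselect (J j).
  have [cJ|] := pselect (forall j, ~ J j -> c j = 0).
    rewrite !big1// => j _; have [Jj|/cJ->] := pselect (J j); rewrite ?mul0r//.
      by rewrite (vJ j).1// mulr0.
    by rewrite (uJ j).1// mulr0.
  move=> /existsNP[j /not_implyP[Jj /eqP cj]].
  have {}cj : 0 < c j by rewrite lt0r cj c0.
  rewrite !gtr0_sg// (bigD1 j)//= ltr_pwDl ?sumr_ge0//.
  - by rewrite mulr_gt0// (vJ j).2.
  - by move=> i _; apply: ge0.
  - by rewrite mulr_gt0// (uJ j).2.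
  - by move=> i _; apply: ge0.
move=> /(affine_root_wall k) [c [[c0|c0] cE]] xJ yJ; rewrite !cE.
  exact: sum_sg.
rewrite sgN [RHS]sgN -!sumrN; congr (- _).
under eq_bigr do rewrite -mulNr; under [in RHS]eq_bigr do rewrite -mulNr.
by apply: (sum_sg (fun j => - c j)) => // j; rewrite oppr_ge0.
Qed.

Lemma affine_root_alcove_sg b k x y : b \in Phi -> alcove x -> alcove y ->
  Num.sg (affine_root ip b k x) = Num.sg (affine_root ip b k y).
Proof. by move=> bP /alcoveP xA /alcoveP; apply: affine_root_sg. Qed.

Lemma affine_root_neq0 b k x : b \in Phi -> alcove x ->
  affine_root ip b k x != 0.
Proof.
move=> bP xA; have [c [c0 cE]] := affine_root_wall k bP.
suff [j cj] : exists j, c j != 0.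
  rewrite cE; case: c0 => c0.
    rewrite gt_eqF// (bigD1 j)//= ltr_pwDl//.
      by rewrite mulr_gt0// lt0r cj c0.
    by rewrite sumr_ge0// => i _; rewrite mulr_ge0// ltW.
  rewrite lt_eqF// (bigD1 j)//= ltr_nwDl//.
    by rewrite nmulr_rlt0// lt_neqAle cj c0.
  by rewrite sumr_le0// => i _; rewrite mulr_le0_ge0// ltW.
(* With all coefficients zero, the affine root would vanish at 0 and at b, giving <b, b> = 0. *)
apply: contrapT => /forallNP c00.
have r0 z : affine_root ip b k z = 0.
  by rewrite cE big1// => j _; have /negP/negPn/eqP -> := c00 j; rewrite mul0r.
have /negP[] := ip_neq0 ip (root_neq0 bP); apply/eqP.
by have := r0 b; have := r0 0; rewrite /affine_root ip0l add0r => ->;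
  rewrite addr0.
Qed.

Lemma wall_reflection_conj k j b : b \in Phi -> exists b' k',
  [/\ b' \in Phi,
      forall x, affine_root ip b k (wall_reflection j x) =
                affine_root ip b' k' x &
      forall x, affine_reflection ip b k (wall_reflection j x) =
                wall_reflection j (affine_reflection ip b' k' x)].
Proof.
move=> bP; have [m gE] := root_int (ext_simple_root_in j) bP.
exists (reflection ip (ext_simple_root alpha theta j) b),
  (k - wall_level j * m).
split; first by rewrite root_reflection// ext_simple_root_in.
  exact: (affine_root_comp _ _ gE (ext_simple_root_neq0 j)).
exact: (affine_reflection_conj _ _ gE (ext_simple_root_neq0 j)).
Qed.

(** Up to a factor, wall j is the only affine root changing sign across facet j. If another wall had
    a positive coefficient, the root would be positive at an interior point z of the facet, which
    the reflection fixes; the reflected root would be positive at z and negative at x, against its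
    constant sign on the closed alcove. *)
Lemma wall_reflection_swap j b k x : b \in Phi -> alcove x ->
  0 < affine_root ip b k x -> affine_root ip b k (wall_reflection j x) < 0 ->
  affine_reflection ip b k =1 wall_reflection j.
Proof.
move=> bP xA bx bjx.
have [c [c0 cE]] := affine_root_wall k bP.
have {}c0 i : 0 <= c i.
  case: c0 => // c0; move: bx; rewrite cE ltNge sumr_le0// => l _.
  by rewrite mulr_le0_ge0// ltW.
have [b' [k' [b'P sE _]]] := wall_reflection_conj k j bP.
have cj i : i != j -> c i = 0.
  move=> ij; apply/eqP; rewrite eq_le c0 andbT leNgt; apply/negP => ci.
  have [z [zj zi]] := facet_neq0 j.
  have zA : closed_alcove z.
    by move=> l; have [->|/zi/ltW//] := eqVneq l j; rewrite zj.
  have bz : 0 < affine_root ip b k z.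
    rewrite cE (bigD1 i)//= ltr_pwDl ?mulr_gt0// ?zi// sumr_ge0// => l _.
    by rewrite mulr_ge0.
  have zE : wall_reflection j z = z.
    rewrite /wall_reflection /affine_reflection -/(wall j z) zj.
    by rewrite scale0r subr0.
  have [h|h] := affine_root_sign k' b'P.
    by have := h x (alcoveW xA); rewrite -sE leNgt bjx.
  by have := h z zA; rewrite -sE zE leNgt bz.
have bE z : affine_root ip b k z = c j * wall j z.
  by rewrite cE (bigD1 j)//= big1 ?addr0// => i /cj->; rewrite mul0r.
apply: (affine_reflection_proportional (c := c j)) => //.
  by apply: contraTneq bx; rewrite bE => ->; rewrite mul0r ltxx.
exact: ext_simple_root_neq0.
Qed.

(** * Action of the affine Weyl group on the alcoves *)

Lemma wall_reflectionK j : involutive (wall_reflection j).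
Proof. exact/affine_reflectionK/ext_simple_root_neq0. Qed.

Lemma wall_reflection_wall j x : wall j (wall_reflection j x) = - wall j x.
Proof. exact/affine_root_reflection/ext_simple_root_neq0. Qed.

Definition walk (s : seq 'I_n.+1) (x : V) : V := foldr wall_reflection x s.

Lemma walk_cat s t x : walk (s ++ t) x = walk s (walk t x).
Proof. exact: foldr_cat. Qed.

Lemma walk_revK s : cancel (walk s) (walk (rev s)).
Proof.
elim: s => // j s IH x.
by rewrite rev_cons -cats1 walk_cat /= wall_reflectionK IH.
Qed.

Lemma affine_root_walk s b k : b \in Phi -> exists b' k', b' \in Phi /\
  forall x, affine_root ip b k (walk s x) = affine_root ip b' k' x.
Proof.
elim: s b k => [|j s IH] b k bP; first by exists b, k.
have [b1 [k1 [b1P sE _]]] := wall_reflection_conj k j bP.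
have [b' [k' [b'P wE]]] := IH b1 k1 b1P.
by exists b', k'; split=> // x; rewrite /= sE.
Qed.

(** An exchange condition: b is carried along the word. At the letter where its sign at x changes,
    [wall_reflection_swap] identifies the carried reflection with that letter, and the two
    cancel. *)
Lemma walk_deletion s b k x : b \in Phi -> alcove x ->
  0 < affine_root ip b k x -> affine_root ip b k (walk s x) < 0 ->
  exists s', (size s' < size s)%N /\
    forall y, affine_reflection ip b k (walk s y) = walk s' y.
Proof.
elim: s b k => [|j s IH] b k bP xA bx /=; first by rewrite ltNge ltW.
have [b' [k' [b'P sE tE]]] := wall_reflection_conj k j bP => bw.
have := affine_root_neq0 k' b'P xA; rewrite neq_lt => /orP[b'x|b'x].
  have E : affine_reflection ip b k =1 wall_reflection j.
    by apply: wall_reflection_swap bx _; rewrite // sE.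
  by exists s; split=> // y; rewrite E wall_reflectionK.
have [|s' [ss' s'E]] := IH b' k' b'P xA b'x; first by rewrite -sE.
by exists (j :: s'); split=> // y; rewrite tE s'E.
Qed.

(* The values at [x] of the affine roots form finitely many classes mod Z. *)
Lemma affine_root_gap x : exists e, 0 < e /\ forall b k, b \in Phi ->
  0 < affine_root ip b k x -> e <= affine_root ip b k x.
Proof.
(* [Num.floor (- ip x b) + 1] is the least integer k with <x, b> + k > 0. *)
pose f b := affine_root ip b (Num.floor (- ip x b) + 1) x.
have [b _|e [e0 eP]] := @seq_lower_bound _ _ (enum_fset Phi) f.
  by rewrite /f /affine_root -ltrBlDl sub0r; exact: floorD1_gt.
exists e; split=> // b k bP bk; apply: le_trans (eP b bP) _.
rewrite /f /affine_root lerD2l ler_int lezD1 floor_lt_int.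
by move: bk; rewrite /affine_root -ltrBlDl sub0r.
Qed.

Lemma affine_reflection_dist b k y p : b \in Phi ->
  let y' := affine_reflection ip b k y in
  ip (y' - p) (y' - p) = ip (y - p) (y - p) +
    4 * affine_root ip b k y * affine_root ip b k p / ip b b.
Proof.
move=> /root_neq0/(ip_neq0 ip) b0 /=.
rewrite /affine_reflection /affine_root /coroot !ipE (ipC _ p y) !(ipC _ b).
by field.
Qed.

(* Reflecting in a violated wall brings the point closer to a fixed interior
   point of the alcove, by an amount bounded below along the whole orbit. *)
Lemma to_closed_alcove x : exists s, closed_alcove (walk s x).
Proof.
have [p pA] := alcove_neq0; have [e [e0 eP]] := affine_root_gap x.
pose N j := ip (ext_simple_root alpha theta j) (ext_simple_root alpha theta j).
have N0 j : 0 < N j by apply/ip_gt0/ext_simple_root_neq0.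
have [j _|d [d0 dP]] := @seq_lower_bound _ _ (enum 'I_n.+1)
    (fun j => 4 * e * wall j p / N j).
  by rewrite !mulr_gt0// invr_gt0.
(* Each reflection lowers the squared distance to p by at least d, so induct on a bound for it in
   units of d. *)
suff H (k : nat) s : ip (walk s x - p) (walk s x - p) < k%:R * d ->
    exists s, closed_alcove (walk s x).
  pose D := ip (x - p) (x - p).
  apply: (H (Num.bound (D / d)) [::]); rewrite -ltr_pdivrMr//.
  by rewrite archi_boundP// divr_ge0 ?ip_ge0// ltW.
elim: k s => [|k IH] s; first by rewrite mul0r ltNge ip_ge0.
move=> sk; have [|/existsNP[j]] := pselect (closed_alcove (walk s x)).
  by exists s.
move=> /negP; rewrite -ltNge => wj; apply: (IH (j :: s)) => /=.
rewrite affine_reflection_dist ?ext_simple_root_in// -/(wall j _) -/(wall j _).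
have [b [k' [bP bE]]] :=
  affine_root_walk s (wall_level j) (ext_simple_root_in j).
have we : wall j (walk s x) <= - e.
  rewrite lerNr /wall bE -affine_rootN eP ?rootN//.
  by rewrite affine_rootN -bE oppr_gt0.
have := dP j (mem_enum _ _); rewrite -/(N j) => dj.
have : 4 * wall j (walk s x) * wall j p / N j <= - (4 * e * wall j p / N j).
  rewrite -mulNr ler_pM2r ?invr_gt0// -mulNr ler_pM2r ?pA// -mulrN.
  by rewrite ler_pM2l.
by move: sk; rewrite -natr1 mulrDl mul1r; lra.
Qed.

(** Reflect an interior point p to q and let s bring q back into the alcove. As b is negative at q,
    the image of [walk s q] under [rev s], [walk_deletion] turns the reflection composed with
    [rev s] into a word. *)
Lemma affine_reflection_walk b k : b \in Phi ->
  exists s, affine_reflection ip b k =1 walk s.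
Proof.
have [p pA] := alcove_neq0.
wlog bp : b k / 0 < affine_root ip b k p.
  move=> H bP; have := affine_root_neq0 k bP pA; rewrite neq_lt.
  move=> /orP[bp|/H]; last exact.
  have [||s sE] := H (- b) (- k); first by rewrite affine_rootN oppr_gt0.
    exact: rootN.
  by exists s => x; rewrite -affine_reflectionN.
move=> bP; have [s sA] := to_closed_alcove (affine_reflection ip b k p).
set q := affine_reflection ip b k p in sA.
have qE : affine_reflection ip b k q = p.
  by rewrite affine_reflectionK// root_neq0.
(* No affine root vanishes at p, hence none at q or along its orbit, so the closed alcove can be
   replaced by the open one. *)
have {}sA : alcove (walk s q).
  move=> j; rewrite lt0r sA andbT /wall.
  have [b1 [k1 [b1P ->]]] :=
    affine_root_walk s (wall_level j) (ext_simple_root_in j).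
  suff : affine_root ip b1 k1 q != 0 by [].
  have [m gE] := root_int bP b1P; have b0 := root_neq0 bP.
  have := affine_root_comp k1 k gE b0 p => /= ->.
  by apply: affine_root_neq0; rewrite ?root_reflection.
have [||s' [_ s'E]] := walk_deletion (s := rev s) bP sA (k := k).
- have : Num.sg (affine_root ip b k (walk s q)) = 1.
    by rewrite -(gtr0_sg bp); apply: affine_root_alcove_sg.
  by move/eqP; rewrite sgr_cp0.
- by rewrite walk_revK affine_root_reflection ?root_neq0// oppr_lt0.
exists (s' ++ s) => y; rewrite walk_cat -s'E.
by rewrite walk_revK.
Qed.

Lemma walk_closed_alcove s x : closed_alcove x -> closed_alcove (walk s x) ->
  walk s x = x /\ (alcove x -> walk s =1 id).
Proof.
have [m] := ubnP (size s); elim: m s => // m IH [|j s] /=; first by [].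
rewrite ltnS => sm xA wA.
(* Taking y = x for interior x rules out the case where x is sent onto wall j. *)
have [y [yA xy]] : exists y, alcove y /\ (alcove x -> x = y).
  have [xA'|nxA] := pselect (alcove x); first by exists x.
  by have [y yA] := alcove_neq0; exists y.
have [b [k [bP bE]]] :=
  affine_root_walk (j :: s) (wall_level j) (ext_simple_root_in j).
have := affine_root_neq0 k bP yA; rewrite neq_lt => /orP[by0|by0]; last first.
  have [|s' [ss' s'E]] := walk_deletion (ext_simple_root_in j) yA
    (yA j : 0 < affine_root ip _ _ y) (s := s).
    by rewrite -oppr_gt0 -[X in 0 < X]wall_reflection_wall /wall (bE y).
  have s'A : closed_alcove (walk s' x) by rewrite -s'E.
  have [s'x s'id] := IH s' (ltn_trans ss' sm) xA s'A.
  split=> [|/s'id s'1 z]; first by rewrite [LHS]s'E.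
  by rewrite [LHS]s'E.
have wj : wall j (wall_reflection j (walk s x)) = 0.
  apply/eqP; rewrite eq_le wA andbT /wall (bE x).
  have [/(_ y (alcoveW yA))|/(_ x xA)//] := affine_root_sign k bP.
  by rewrite leNgt by0.
have {}wj : wall j (walk s x) = 0.
  by apply/eqP; rewrite -oppr_eq0 -wall_reflection_wall wj.
have sE : wall_reflection j (walk s x) = walk s x.
  by rewrite /wall_reflection /affine_reflection -/(wall j _) wj scale0r subr0.
rewrite sE in wA *; have [-> _] := IH s sm xA wA; split=> // /xy xE.
by move: by0; rewrite -xE -bE -/(wall j _) /= sE wj ltxx.
Qed.

(** * Weyl group and coroot lattice *)

Local Notation W := (weyl_group ip Phi).
Local Notation L := (coroot_lattice ip Phi).

Lemma weylD w x y : W w -> w (x + y) = w x + w y.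
Proof. by elim=> [|b u bP _ IH] //=; rewrite IH reflectionD. Qed.

Lemma weylZ w c x : W w -> w (c *: x) = c *: w x.
Proof. by elim=> [|b u bP _ IH] //=; rewrite IH reflectionZ. Qed.

Lemma weyl0 w : W w -> w 0 = 0.
Proof. by move=> wW; have := weylZ 0 0 wW; rewrite !scale0r. Qed.

Lemma ip_weyl w x y : W w -> ip (w x) (w y) = ip x y.
Proof. by elim=> [|b u bP _ IH] //=; rewrite ip_reflection ?root_neq0. Qed.

Lemma root_weyl w b : W w -> b \in Phi -> w b \in Phi.
Proof. by elim=> [|g u gP _ IH] bP //=; rewrite root_reflection ?IH. Qed.

Lemma weyl_comp v w : W v -> W w -> W (v \o w).
Proof.
by move=> + wW; elim=> // b u bP _ IH; exact: (weyl_refl bP IH).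
Qed.

Lemma weyl_inv w : W w -> exists v, [/\ W v, cancel w v & cancel v w].
Proof.
elim=> [|b u bP _ [v [vW uK vK]]]; first by exists id; split=> //; left.
exists (v \o reflection ip b); split.
- by apply: weyl_comp => //; exact: (weyl_refl bP (weyl_id _ _)).
- by move=> x; rewrite /= reflectionK ?root_neq0.
- by move=> x; rewrite /= vK reflectionK ?root_neq0.
Qed.

Lemma lattice0 : L 0.
Proof. by exists (fun=> 0) => //; rewrite big1// => b _; rewrite mulr0z. Qed.

Lemma latticeD x y : L x -> L y -> L (x + y).
Proof.
move=> [c _ <-] [d _ <-]; exists (fun b => c b + d b) => //.
by rewrite -big_split/=; apply: eq_bigr => b _; rewrite mulrzDr.
Qed.

Lemma latticeN x : L x -> L (- x).
Proof.
move=> [c _ <-]; exists (fun b => - c b) => //.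
by rewrite -sumrN; apply: eq_bigr => b _; rewrite mulrNz.
Qed.

Lemma latticeB x y : L x -> L y -> L (x - y).
Proof. by move=> xL /latticeN; apply: latticeD. Qed.

Lemma lattice_coroot b k : b \in Phi -> L (k%:~R *: coroot ip b).
Proof.
move=> bP; exists (fun g => if g == b then k else 0) => //.
rewrite (big_fsetD1 b)//= eqxx scaler_int big_seq big1 ?addr0// => g.
by rewrite !inE => /andP[/negPf -> _].
Qed.

Lemma lattice_ind (P : V -> Prop) :
  P 0 -> (forall x y, P x -> P y -> P (x + y)) ->
  (forall b k, b \in Phi -> P (k%:~R *: coroot ip b)) -> forall x, L x -> P x.
Proof.
move=> P0 PD Pb x [c _ <-]; rewrite big_seq; apply: big_ind => // b bP.
by rewrite -scaler_int; apply: Pb.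
Qed.

Lemma lattice_int x b : L x -> b \in Phi -> exists k : int, ip x b = k%:~R.
Proof.
move=> xL bP; elim/lattice_ind: x / xL => [|x y [k kE] [l lE]|g k gP].
- by exists 0; rewrite ip0l.
- by exists (k + l); rewrite ipDl kE lE rmorphD.
have [m mE] := root_int gP bP.
by exists (k * m); rewrite ipZl ipC mE rmorphM.
Qed.

Lemma lattice_weyl w x : W w -> L x -> L (w x).
Proof.
elim=> // b u bP _ IH /IH uL /=; rewrite reflectionE.
by have [k ->] := lattice_int uL bP; apply/latticeB/lattice_coroot.
Qed.

Lemma walk_decomp s : exists w m, [/\ W w, L m & forall x, walk s x = w x + m].
Proof.
elim: s => [|j s [w [m [wW mL sE]]]].
  by exists id, 0; split=> [||x]; rewrite ?addr0//; [left|exact: lattice0].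
set g := ext_simple_root alpha theta j.
have gP : g \in Phi by exact: ext_simple_root_in.
exists (reflection ip g \o w),
  (reflection ip g m - (wall_level j)%:~R *: coroot ip g).
split=> [||x]; first exact: weyl_refl.
  apply: latticeB; last exact: lattice_coroot.
  exact: (lattice_weyl (weyl_refl gP (weyl_id _ _)) mL).
by rewrite /= sE [LHS]affine_reflectionE reflectionD -addrA.
Qed.

Lemma weyl_walk w : W w -> exists s, w =1 walk s.
Proof.
elim=> [|b u bP _ [s sE]]; first by exists [::].
have [t tE] := affine_reflection_walk 0 bP.
by exists (t ++ s) => x; rewrite /= sE walk_cat -tE affine_reflection0.
Qed.

(** Translation by k times the coroot of b is the product of the reflections of levels 0 and -k in
    parallel mirrors. *)
Lemma translation_walk m : L m -> exists s, forall x, x + m = walk s x.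
Proof.
move=> mL; elim/lattice_ind: m / mL => [|x y [s sE] [t tE]|b k bP].
- by exists [::] => x; rewrite addr0.
- by exists (t ++ s) => z; rewrite addrA sE tE walk_cat.
have [s sE] := affine_reflection_walk (- k) bP.
have [t tE] := affine_reflection_walk 0 bP.
exists (s ++ t) => x; rewrite walk_cat -sE -tE affine_reflection0.
rewrite affine_reflectionE reflectionK ?root_neq0//.
by rewrite rmorphN scaleNr opprK.
Qed.

Lemma affine_weyl_closed_alcove z :
  exists w m y, [/\ W w, L m, closed_alcove y & z = w y + m].
Proof.
have [s sA] := to_closed_alcove z; have [v [m [vW mL sE]]] := walk_decomp s.
have [w [wW vK wK]] := weyl_inv vW.
exists w, (- w m), (walk s z); split=> //; first exact/latticeN/lattice_weyl.
by rewrite sE weylD// addrK vK.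
Qed.

(** Apply [walk_closed_alcove] to the map x -> w'^-1 (w x + m - m'), which sends y to y'. For
    interior y it is the identity, and evaluation at 0 gives m = m'. *)
Lemma closed_alcove_unique w m y w' m' y' : W w -> L m -> W w' -> L m' ->
  closed_alcove y -> closed_alcove y' -> w y + m = w' y' + m' ->
  y' = y /\ (alcove y -> w = w').
Proof.
move=> wW mL w'W m'L yA y'A E; have [v [vW vK vK']] := weyl_inv w'W.
have [s sE] := weyl_walk wW; have [t tE] := weyl_walk vW.
have [r rE] := translation_walk (latticeB mL m'L).
have gE x : walk (t ++ r ++ s) x = v (w x + (m - m')).
  by rewrite !walk_cat -sE -rE -tE.
have gy : walk (t ++ r ++ s) y = y'.
  by rewrite gE addrA E addrK vK.
have [|yy' id_g] := walk_closed_alcove (s := t ++ r ++ s) yA.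
  by rewrite gy.
split=> [|/id_g g1]; first by rewrite -gy.
have wE x : w x + (m - m') = w' x by rewrite -[w' x](congr1 w' (g1 x)) gE vK'.
have m0 : m - m' = 0 by have := wE 0; rewrite !weyl0// add0r.
by apply/funext => x; rewrite -wE m0 addr0.
Qed.

Lemma affine_root_weyl w m b k : W w -> L m -> b \in Phi ->
  exists l, forall x, affine_root ip (w b) l (w x + m) = affine_root ip b k x.
Proof.
move=> wW mL bP; have [l lE] := lattice_int mL (root_weyl wW bP).
exists (k - l) => x; rewrite /affine_root ipDl ip_weyl// lE rmorphB/=.
by rewrite -addrA subrKC.
Qed.

(** * Cells of the Steinberg torus *)

Lemma same_sideP x y : same_side ip Phi x y <-> forall b k, b \in Phi ->
  Num.sg (affine_root ip b k x) = Num.sg (affine_root ip b k y).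
Proof.
split=> h b k bP; last first.
  by have := h b (- k) bP; rewrite /affine_root rmorphN.
by have := h b (- k) bP; rewrite rmorphN opprK.
Qed.

Lemma same_side_affine_weyl w m x y : W w -> L m ->
  same_side ip Phi x y <-> same_side ip Phi (w x + m) (w y + m).
Proof.
suff H v l z t : W v -> L l -> same_side ip Phi (v z + l) (v t + l) ->
    same_side ip Phi z t.
  move=> wW mL; split; last exact: H.
  have [v [vW wK vK]] := weyl_inv wW.
  move=> xy; apply: (H v (- v m)) => //; first exact/latticeN/lattice_weyl.
  by rewrite !(weylD _ _ vW) !addrK !wK.
move=> vW lL /same_sideP h; apply/same_sideP => b k bP.
have [i iE] := affine_root_weyl k vW lL bP.
by rewrite -!iE h// root_weyl.
Qed.

Lemma alcove_face_same_side J x y : alcove_face ip alpha theta J x ->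
  same_side ip Phi x y <-> alcove_face ip alpha theta J y.
Proof.
move=> xJ; split=> [/same_sideP h|yJ]; last first.
  by apply/same_sideP => b k bP; apply: affine_root_sg xJ yJ.
apply/alcove_faceP => j; have [x0 x1] := (alcove_faceP J x).1 xJ j.
have sE := h _ (wall_level j) (ext_simple_root_in j).
rewrite -/(wall j x) -/(wall j y) in sE; split=> Jj.
  by apply/eqP; rewrite -sgr_eq0 -sE x0// sgr0.
by move/eqP: sE; rewrite gtr0_sg ?x1// eq_sym sgr_cp0.
Qed.

Lemma alcove_face_proper J x : alcove_face ip alpha theta J x ->
  J `<` [set: 'I_n.+1].
Proof.
move/alcove_faceP => xJ; rewrite properEneq; split=> //; apply/eqP => JT.
have [m [_ /(_ x)]] := wall_partition_of_unity.
by rewrite big1 => [/eqP|j _]; rewrite ?(eq_sym 0) ?oner_eq0//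
  (xJ j).1 ?JT ?mulr0.
Qed.

Lemma alcove_face_inj J K x : alcove_face ip alpha theta J x ->
  alcove_face ip alpha theta K x -> J = K.
Proof.
have sub (A B : set 'I_n.+1) : alcove_face ip alpha theta A x ->
    alcove_face ip alpha theta B x -> A `<=` B.
  move=> /alcove_faceP xA /alcove_faceP xB j /(xA j).1 x0.
  by apply: contrapT => /(xB j).2; rewrite x0 ltxx.
by move=> xJ xK; apply/seteqP; split; apply: sub.
Qed.

Definition zero_walls x : set 'I_n.+1 := [set j | wall j x = 0].

Lemma alcove_face_zero_walls x : closed_alcove x ->
  alcove_face ip alpha theta (zero_walls x) x.
Proof.
move=> xA; apply/alcove_faceP => j; split=> // /eqP x0.
by rewrite lt0r x0 xA.
Qed.

Lemma alcove_face_closed J x : alcove_face ip alpha theta J x ->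
  closed_alcove x.
Proof.
move=> /alcove_faceP xJ j.
by have [/(xJ j).1->|/(xJ j).2/ltW] := pselect (J j).
Qed.

(** Turns descents into strict inequalities: p pairs positively with every simple root and is
    orthogonal to no root. *)
Lemma negative_rootP b p : b \in Phi -> alcove p ->
  negative_root Phi alpha b <-> ip p b < 0.
Proof.
move=> bP pA.
have pb0 : ip p b != 0 by have := affine_root_neq0 0 bP pA;
  rewrite /affine_root addr0.
have pos c : nonneg_comb alpha c -> 0 <= ip p c.
  move=> [d]; rewrite nonneg_combE => ->; rewrite ip_suml sumr_ge0// => i _.
  by rewrite mulr_ge0// -wall_lift ltW.
split=> [[_ /pos]|pb]; first by rewrite ipNr oppr_ge0 lt_neqAle pb0.
split=> //; case: alpha_simple => _ _ _ /(_ b bP)[/pos|//].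
by rewrite leNgt pb.
Qed.

Local Notation Des := (affine_descents Phi alpha theta).
Local Notation F := (torus_cell ip Phi alpha theta).
Local Notation face := (alcove_face ip alpha theta).
Local Notation cells := (reduced_steinberg_torus ip Phi).

Lemma torus_cellP w J z :
  F w J z <-> exists x m, [/\ face J x, L m & z = w x + m].
Proof.
split=> [[_ [x xJ <-]] [m mL <-]|[x [m [xJ mL ->]]]]; first by exists x, m.
by exists (w x); [exists x|exists m].
Qed.

(** A_J is one class of [same_side], a relation invariant under the affine Weyl group, so a torus
    cell is determined by any of its points. *)
Lemma torus_cell_class w J z : W w -> F w J z ->
  F w J = torus_image ip Phi [set y | same_side ip Phi z y].
Proof.
move=> wW /torus_cellP [x [m [xJ mL zE]]]; apply/seteqP; split=> y.
  move=> /torus_cellP [x1 [m1 [x1J m1L ->]]].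
  exists (w x1 + m); last by exists (m1 - m); [exact: latticeB|
    rewrite -addrA subrKC].
  by rewrite /= zE; apply/(same_side_affine_weyl x x1 wW mL)/
    (alcove_face_same_side x1 xJ).
move=> [y1 /= zy1 [m1 m1L <-]].
have [v [vW wK vK]] := weyl_inv wW.
have y1E : y1 = w (v (y1 - m)) + m by rewrite vK subrK.
apply/torus_cellP; exists (v (y1 - m)), (m + m1).
split; [|exact: latticeD|by rewrite addrA -y1E].
apply/(alcove_face_same_side _ xJ)/(same_side_affine_weyl x _ wW mL).
by rewrite -zE -y1E.
Qed.

Lemma torus_cell_meet w J w' J' z : W w -> W w' -> F w J z -> F w' J' z ->
  F w J = F w' J'.
Proof. by move=> wW w'W /torus_cell_class -> // /torus_cell_class ->. Qed.

Lemma torus_cell_neq0 w J : J `<` [set: 'I_n.+1] -> exists z, F w J z.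
Proof.
move=> /alcove_face_neq0 [x xJ]; exists (w x); apply/torus_cellP.
by exists x, 0; rewrite addr0; split=> //; exact: lattice0.
Qed.

Lemma torus_cell_cells w J : W w -> J `<` [set: 'I_n.+1] -> cells (F w J).
Proof.
move=> wW JT; have [z zF] := torus_cell_neq0 w JT.
split; last by move=> /= F0; rewrite F0 in zF.
exists [set y | same_side ip Phi z y]; first by right; exists z.
by rewrite -(torus_cell_class wW zF).
Qed.

(** * Perturbation by a regular dominant vector *)

Lemma affine_root_near z : exists r, 0 < r /\ forall y, `|y - z| < r ->
  forall b k, b \in Phi -> 0 < affine_root ip b k z -> 0 < affine_root ip b k y.
Proof.
have [g [g0 gP]] := affine_root_gap z.
(* The added 1 keeps the divisor positive and makes the final bound strict. *)
have b1 b : 0 < 1 + Num.sqrt (ip b b) by rewrite ltr_pwDl// sqrtr_ge0.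
have [b _|r [r0 rP]] := @seq_lower_bound _ _ (enum_fset Phi)
    (fun b => g / (1 + Num.sqrt (ip b b))).
  by rewrite divr_gt0.
exists r; split=> // y yz b k bP bz.
(* By Cauchy-Schwarz and [ip_norm], values move by less than the gap g of the positive values at
   z. *)
have : `|ip (y - z) b| < g.
  have : `|ip (y - z) b| <= `|y - z| * Num.sqrt (ip b b).
    rewrite -ler_sqr ?nnegrE ?mulr_ge0 ?sqrtr_ge0// real_normK ?num_real//.
    by rewrite exprMn sqr_sqrtr ?ip_ge0// -ip_norm cauchy_schwarz.
  move=> /le_lt_trans; apply.
  have := rP b bP; rewrite ler_pdivlMr// mulrDr mulr1.
  have : `|y - z| * Num.sqrt (ip b b) <= r * Num.sqrt (ip b b).
    by rewrite ler_wpM2r ?sqrtr_ge0// ltW.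
  by lra.
rewrite ltr_norml => /andP[h _]; have := gP b k bP bz; move: h.
by rewrite /affine_root ipDl ipNl; lra.
Qed.

Lemma perturbation_zero b k z e p : affine_root ip b k z = 0 ->
  affine_root ip b k (z + e *: p) = e * ip p b.
Proof. by rewrite /affine_root ipDl addrAC => ->; rewrite add0r ipZl. Qed.

(** Affine roots nonzero at z keep their sign for small e; those vanishing at z take the value e <p,
    b>, nonzero since p is regular. *)
Lemma perturbation z p : alcove p -> exists e, [/\ 0 < e,
  forall b k, b \in Phi -> 0 < affine_root ip b k z ->
    0 < affine_root ip b k (z + e *: p) &
  forall b k, b \in Phi -> affine_root ip b k (z + e *: p) != 0].
Proof.
move=> pA; have [r [r0 rP]] := affine_root_near z.
have p1 : 0 < 1 + `|p| by rewrite ltr_pwDl.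
pose e := r / (1 + `|p|); have e0 : 0 < e by rewrite divr_gt0.
have pos b k : b \in Phi -> 0 < affine_root ip b k z ->
    0 < affine_root ip b k (z + e *: p).
  apply: rP; rewrite addrC addKr normrZ gtr0_norm// /e mulrAC ltr_pdivrMr//.
  by rewrite ltr_pM2l// ltrDr.
exists e; split=> // b k bP; have [bz|bz|bz] := ltgtP (affine_root ip b k z) 0.
- rewrite -oppr_eq0 -affine_rootN gt_eqF// pos ?rootN//.
  by rewrite affine_rootN oppr_gt0.
- by rewrite gt_eqF// pos.
rewrite perturbation_zero// mulf_neq0 ?(gt_eqF e0)//.
have := affine_root_neq0 0 bP pA.
by rewrite /affine_root addr0.
Qed.

(** Off J the walls stay positive by the choice of e. For j in J the wall goes from 0 to e <p, w
    alpha_j>, positive because j is not a descent. *)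
Lemma perturbation_alcove w m x J e p : W w -> L m -> face J x ->
  Des w `&` J = set0 -> alcove p -> 0 < e ->
  (forall b k, b \in Phi -> 0 < affine_root ip b k (w x + m) ->
     0 < affine_root ip b k (w x + m + e *: p)) ->
  exists y, alcove y /\ w x + m + e *: p = w y + m.
Proof.
move=> wW mL /alcove_faceP xJ DJ pA e0 eP.
have [v [vW wK vK]] := weyl_inv wW.
have yE : w x + m + e *: p = w (x + e *: v p) + m.
  by rewrite (weylD _ _ wW) (weylZ _ _ wW) vK addrAC.
exists (x + e *: v p); split=> // j.
have jP := ext_simple_root_in j; have wjP := root_weyl wW jP.
have [l lE] := affine_root_weyl (wall_level j) wW mL jP.
rewrite /wall -lE -yE; have [Jj|/(xJ j).2 xj] := pselect (J j); last first.
  by apply: eP => //; rewrite lE.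
rewrite perturbation_zero; last by rewrite lE; apply: (xJ j).1.
rewrite pmulr_rgt0// lt0r; apply/andP; split.
  by have := affine_root_neq0 0 wjP pA; rewrite /affine_root addr0.
rewrite leNgt; apply/negP => /(negative_rootP wjP pA) jD.
by have : (Des w `&` J) j by []; rewrite DJ.
Qed.

(* The pair (w, J) is found from the alcove containing z + e p for a small
   e > 0, where p is a fixed dominant regular vector. *)
Lemma descent_free_repr z : exists w J,
  [/\ W w, J `<` [set: 'I_n.+1], Des w `&` J = set0 & F w J z].
Proof.
have [p pA] := alcove_neq0; have [e [e0 eP eN]] := perturbation z pA.
have [w [m [y [wW mL yA yE]]]] := affine_weyl_closed_alcove (z + e *: p).
have [v [vW wK vK]] := weyl_inv wW.
have zE : z = w (v (z - m)) + m by rewrite vK subrK.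
set x := v (z - m) in zE.
have wj j : exists l, affine_root ip (w (ext_simple_root alpha theta j)) l z
      = wall j x /\
    affine_root ip (w (ext_simple_root alpha theta j)) l (z + e *: p)
      = wall j y.
  have [l lE] := affine_root_weyl (wall_level j) wW mL (ext_simple_root_in j).
  by exists l; rewrite yE {1}zE !lE.
have jP j := root_weyl wW (ext_simple_root_in j).
have xA : closed_alcove x.
  move=> j; have [l [lx ly]] := wj j; rewrite leNgt; apply/negP => xj.
  have := eP _ (- l) (rootN (jP j)); rewrite !affine_rootN lx ly.
  by rewrite !oppr_gt0 => /(_ xj); rewrite ltNge yA.
have xF := alcove_face_zero_walls xA.
exists w, (zero_walls x); split=> //; first exact: alcove_face_proper xF.
  apply/seteqP; split=> // j [jD xj].
  have [l [lx ly]] := wj j; have := yA j.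
  rewrite -ly perturbation_zero ?lx// pmulr_rge0// leNgt.
  by rewrite (negative_rootP (jP j) pA).1.
by apply/torus_cellP; exists x, m.
Qed.

Lemma cell_descent_free X : cells X -> exists w J,
  [/\ W w, J `<` [set: 'I_n.+1], Des w `&` J = set0 & X = F w J].
Proof.
move=> [[_ [->|[z ->]] <-] X0]; first 
  by case: X0; apply/seteqP; split=> // y [x []].
have [w [J [wW JT DJ zF]]] := descent_free_repr z.
by exists w, J; split=> //; rewrite (torus_cell_class wW zF).
Qed.

(** A common point pushed by e p lies in the open alcoves of both w and w', so w = w'. Then J is
    read off the representative in the closed alcove, which is unique. *)
Lemma descent_free_unique w J w' J' : W w -> W w' -> J `<` [set: 'I_n.+1] ->
  Des w `&` J = set0 -> Des w' `&` J' = set0 -> F w J = F w' J' ->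
  w = w' /\ J = J'.
Proof.
move=> wW w'W /alcove_face_neq0 [x xJ] DJ DJ' FE.
have : F w J (w x + 0) by apply/torus_cellP; exists x, 0; split=> //;
  exact: lattice0.
rewrite FE => /torus_cellP [x' [m' [x'J' m'L xE]]].
have [p pA] := alcove_neq0.
have [e [e0 eP _]] := perturbation (w x + 0) pA.
have [y [yA yE]] := perturbation_alcove wW lattice0 xJ DJ pA e0 eP.
rewrite xE in eP yE.
have [y' [y'A y'E]] := perturbation_alcove w'W m'L x'J' DJ' pA e0 eP.
rewrite y'E in yE.
have [_ /(_ y'A) ww'] := closed_alcove_unique w'W m'L wW lattice0
  (alcoveW y'A) (alcoveW yA) yE.
split=> //; have [xx' _] := closed_alcove_unique wW lattice0 w'W m'L
  (alcove_face_closed xJ) (alcove_face_closed x'J') xE.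
by apply: alcove_face_inj xJ _; rewrite -xx'.
Qed.

(** * Closures, faces and colors *)

Lemma closure_torus_cellP w J z : W w -> J `<` [set: 'I_n.+1] ->
  closure (F w J) z <-> exists x m,
    [/\ closed_alcove x, J `<=` zero_walls x, L m & z = w x + m].
Proof.
move=> wW JT; split=> [zF|[x [m [xA xJ mL zE]]]].
  (* Affine roots nonzero at z keep their sign at a nearby point of the cell, so the walls at x
     inherit the weak inequalities, and the equalities on J, from t. *)
  have [r [r0 rP]] := affine_root_near z.
  have [y [/torus_cellP [t [m [tJ mL yE]]] /= zy]] := zF _ (nbhsx_ballx z r r0).
  have {zy} : `|y - z| < r by move: zy; rewrite -ball_normE /= distrC.
  move=> /rP {}rP; have [v [vW wK vK]] := weyl_inv wW.
  have zE : z = w (v (z - m)) + m by rewrite vK subrK.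
  set x := v (z - m) in zE; exists x, m.
  have wj j (s : bool) : 0 < (-1) ^+ s * wall j x -> 0 < (-1) ^+ s * wall j t.
    have jP := ext_simple_root_in j.
    have [l lE] := affine_root_weyl (wall_level j) wW mL jP.
    have wjP := root_weyl wW jP.
    rewrite /wall -!lE -zE -yE; case: s.
      by rewrite expr1 !mulN1r -!affine_rootN; apply: rP; apply: rootN.
    by rewrite !mul1r; apply: rP.
  have tA := alcove_face_closed tJ.
  have xA : closed_alcove x.
    move=> j; rewrite leNgt; apply/negP => xj; have := wj j true.
    by rewrite expr1 !mulN1r !oppr_gt0 => /(_ xj); rewrite ltNge tA.
  split=> // j Jj; apply/eqP; rewrite eq_le xA andbT leNgt; apply/negP => xj.
  have := wj j false; rewrite !mul1r => /(_ xj).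
  by rewrite (((alcove_faceP J t).1 tJ j).1 Jj) ltxx.
(* Conversely, moving from x slightly towards a point p of A_J enters A_J at once. *)
have [p /alcove_faceP pJ] := alcove_face_neq0 JT.
move=> U /nbhs_ballP [r /= r0 rU].
(* This d ensures both t < 1 and a displacement shorter than r. *)
pose d := 1 + r + `|w (p - x)|.
have d0 : 0 < d by rewrite /d -addrA ltr_pwDl// addr_ge0// ltW.
pose t := r / d; have t0 : 0 < t by rewrite divr_gt0.
have t1 : t < 1.
  by rewrite ltr_pdivrMr// mul1r /d; have := normr_ge0 (w (p - x)); lra.
have tE j : wall j (x + t *: (p - x)) = (1 - t) * wall j x + t * wall j p.
  by rewrite /wall /affine_root !ipE; ring.
exists (w (x + t *: (p - x)) + m); split.
  apply/torus_cellP; exists (x + t *: (p - x)), m; split=> //.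
  apply/alcove_faceP => j; rewrite tE; split=> Jj.
    by rewrite (xJ j Jj) (pJ j).1// !mulr0 addr0.
  by rewrite ltr_wpDl ?mulr_ge0 ?subr_ge0 ?(ltW t1)// mulr_gt0// (pJ j).2.
apply: rU; rewrite -ball_normE /= zE (weylD _ _ wW) (weylZ _ _ wW) distrC.
rewrite opprD addrACA subrr addr0 addrC addKr.
rewrite normrZ gtr0_norm// /t mulrAC ltr_pdivrMr// ltr_pM2l// /d.
by lra.
Qed.

Lemma cell_le_torus_cell w J K : W w -> J `<=` K -> K `<` [set: 'I_n.+1] ->
  cell_le (F w K) (F w J).
Proof.
move=> wW JK KT z /(closure_torus_cellP _ wW KT) [x [m [xA xK mL zE]]].
apply/closure_torus_cellP => //.
  by split=> // TJ; apply: KT.2; apply: subset_trans JK.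
by exists x, m; split=> //; apply: subset_trans xK.
Qed.

(** A point of X lies in the closure of F(w, J), hence in F(w, K) with K the zero walls of its
    representative; torus cells that meet coincide. *)
Lemma cell_le_torus_cellP w J X : W w -> J `<` [set: 'I_n.+1] -> cells X ->
  cell_le X (F w J) ->
  exists K, [/\ K `<` [set: 'I_n.+1], J `<=` K & X = F w K].
Proof.
move=> wW JT /cell_descent_free [w' [J' [w'W J'T _ ->]]] le.
have [z zF] := torus_cell_neq0 w' J'T.
have /le/(closure_torus_cellP _ wW JT) [x [m [xA xJ mL zE]]] :=
  subset_closure zF.
have xF := alcove_face_zero_walls xA.
exists (zero_walls x); split=> //; first exact: alcove_face_proper xF.
by apply: torus_cell_meet zF _ => //; apply/torus_cellP; exists x, m.
Qed.

(** By [closed_alcove_unique], a vertex of color j in the closure is represented in the closed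
    alcove by a point where wall j is positive, whereas the walls in J vanish there. *)
Lemma color_set_torus_cell w J : W w -> J `<` [set: 'I_n.+1] ->
  color_set ip Phi alpha theta (F w J) = ~` J.
Proof.
move=> wW JT.
have jT (j : 'I_n.+1) : ~` [set j] `<` [set: 'I_n.+1].
  by rewrite properEneq; split=> //; apply/eqP => /seteqP[_ /(_ j I)]; apply.
apply/seteqP; split=> [j [w' w'W le] Jj|j Jj]; last first.
  exists w => //; apply: cell_le_torus_cell => // i Ji /= ij.
  by rewrite ij in Ji.
have [x' x'F] := alcove_face_neq0 (jT j).
have : F w' (~` [set j]) (w' x' + 0).
  by apply/torus_cellP; exists x', 0; split=> //; exact: lattice0.
move=> /subset_closure/le/(closure_torus_cellP _ wW JT) [x [m [xA xJ mL xE]]].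
have [xx' _] := closed_alcove_unique w'W lattice0 wW mL
  (alcove_face_closed x'F) xA xE.
have := ((alcove_faceP _ x').1 x'F j).2 (fun h => h erefl).
by rewrite -xx' (xJ j Jj) ltxx.
Qed.

Lemma maximal_torus_cell w : W w -> maximal_cell cells cell_le (F w set0).
Proof.
move=> wW; have [y yA] := alcove_neq0; have yF := (alcoveP y).2 yA.
split; first exact: torus_cell_cells wW (alcove_face_proper yF).
move=> X /cell_descent_free [w' [J' [w'W J'T _ ->]]] le.
have : F w set0 (w y + 0).
  by apply/torus_cellP; exists y, 0; split=> //; exact: lattice0.
move=> /subset_closure/le/(closure_torus_cellP _ w'W J'T) [x [m [xA xJ mL xE]]].
have [xy /(_ yA) ww'] := closed_alcove_unique wW lattice0 w'W mL
  (alcoveW yA) xA xE.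
rewrite ww'; congr (F _ _); apply/seteqP; split=> // j /xJ /=.
by rewrite /zero_walls/= xy => y0; have := yA j; rewrite y0 ltxx.
Qed.

Lemma set0_proper : set0 `<` [set: 'I_n.+1].
Proof. by split=> // /(_ ord0 I). Qed.

(** * Descents and the partition into intervals *)

Lemma descents_neq0 w : W w -> exists j, Des w j.
Proof.
move=> wW; have [v [vW wK vK]] := weyl_inv wW; have [p pA] := alcove_neq0.
apply: contrapT => /forallNP D0.
have [m [m0 mE]] := wall_partition_of_unity.
(* Comparing the partition of unity at [v p] and at 0 shows that the m_j <p, w alpha_j> sum to 0;
   without descents every term would be positive. *)
have : \sum_j m j * wall j (v p) - \sum_j m j * wall j 0 = 0.
  by rewrite !mE subrr.
rewrite -sumrB; apply/eqP; rewrite gt_eqF//.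
have h j : 0 < m j * wall j (v p) - m j * wall j 0.
  rewrite -mulrBr mulr_gt0// /wall /affine_root ip0l add0r addrK.
  have wjP := root_weyl wW (ext_simple_root_in j).
  rewrite -(ip_weyl _ _ wW) vK lt0r; apply/andP; split.
    by have := affine_root_neq0 0 wjP pA; rewrite /affine_root addr0.
  by rewrite leNgt; apply/negP => /(negative_rootP wjP pA) /D0.
by rewrite big_ord_recl ltr_pwDl// sumr_ge0// => i _; rewrite ltW.
Qed.

Lemma descents_proper w : W w -> ~` Des w `<` [set: 'I_n.+1].
Proof.
move=> wW; have [j jD] := descents_neq0 wW.
by rewrite properEneq; split=> //; apply/eqP => /seteqP[_ /(_ j I)]; apply.
Qed.

(** The converse uses colors: a cell above F(w, complement of Des w) has all colors in Des w, so its
    set K of walls avoids Des w. *)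
Lemma interval_torus_cell w X : W w ->
  (exists J, [/\ J `<` [set: 'I_n.+1], Des w `&` J = set0 & X = F w J]) <->
  [/\ cells X, cell_le X (F w set0) & cell_le (F w (~` Des w)) X].
Proof.
move=> wW; have DT := descents_proper wW.
split=> [[J [JT DJ ->]]|[cX X0 DX]].
  split; first exact: torus_cell_cells.
    exact: cell_le_torus_cell.
  by apply: cell_le_torus_cell => // j Jj jD; have : (Des w `&` J) j by [];
    rewrite DJ.
have [K [KT _ XE]] := cell_le_torus_cellP wW set0_proper cX X0.
exists K; split=> //; apply/seteqP; split=> // j [jD Kj].
have : color_set ip Phi alpha theta (F w (~` Des w)) j.
  by rewrite color_set_torus_cell// setCK.
move=> [w' w'W le].
have : color_set ip Phi alpha theta X j.
  by exists w' => //; apply: subset_trans DX.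
by rewrite XE color_set_torus_cell.
Qed.

Lemma maximal_cellP X : maximal_cell cells cell_le X <->
  exists2 w, W w & X = F w set0.
Proof.
split=> [[cX Xmax]|[w wW ->]]; last exact: maximal_torus_cell.
have [w [J [wW JT _ XE]]] := cell_descent_free cX; exists w => //.
apply/esym/Xmax; first exact: torus_cell_cells wW set0_proper.
by rewrite XE; apply: cell_le_torus_cell.
Qed.

Lemma maximal_torus_cell_inj w w' : W w -> W w' ->
  F w set0 = F w' set0 -> w = w'.
Proof.
move=> wW w'W; case/(descent_free_unique wW w'W set0_proper) => //;
  exact: setI0.
Qed.

Lemma partitionable_torus : partitionable cells cell_le.
Proof.
(* On a maximal cell the bottom is well defined because the cell determines w; elsewhere X is a mere
   default. *)
have [|G GE] := choice (P := fun X Y =>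
    forall w, W w -> X = F w set0 -> Y = F w (~` Des w)).
  move=> X; have [[w wW XE]|nX] := pselect (exists2 w, W w & X = F w set0).
    exists (F w (~` Des w)) => w' w'W; rewrite XE => /maximal_torus_cell_inj.
    by move=> ->.
  by exists X => w wW XE; case: nX; exists w.
exists G; split=> [X /maximal_cellP [w wW XE]|X cX].
  rewrite (GE X w)// XE; split.
    exact: torus_cell_cells wW (descents_proper wW).
  exact: cell_le_torus_cell (descents_proper wW).
have [w [J [wW JT DJ XE]]] := cell_descent_free cX.
exists (F w set0); split=> [|Y [/maximal_cellP [w' w'W ->]]].
  have [_ X0 DX] : [/\ cells X, cell_le X (F w set0) &
      cell_le (F w (~` Des w)) X].
    by apply/interval_torus_cell => //; exists J.
  by split=> //; [exact: maximal_torus_cell|rewrite (GE _ w)].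
rewrite (GE _ w')// => GX XY.
have [//|J' [J'T DJ' XE']] := (interval_torus_cell X w'W).2.
suff [-> _] : w = w' /\ J = J' by [].
by apply: descent_free_unique; rewrite // -XE.
Qed.

End Alcoves.

Unset Implicit Arguments.

Theorem mainTheorem5 (R : realType) (V : normedModType R)
    (ip : {dot V for @idfun R})
    (ip_norm : forall x : V, ip x x = `|x| ^+ 2)
    (n : nat) (Phi : {fset V}) (alpha : 'I_n -> V) (theta : V)
    (Phi_root : crystallographic_root_system ip Phi)
    (Phi_irr : irreducible_root_system ip Phi)
    (alpha_simple : simple_roots Phi alpha)
    (theta_highest : highest_root Phi alpha theta) :
  let W := weyl_group ip Phi in
  let Des := affine_descents Phi alpha theta in
  let F := torus_cell ip Phi alpha theta in
  let cells := reduced_steinberg_torus ip Phi in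
  let colors := color_set ip Phi alpha theta in
  [/\ (forall w J, W w -> J `<` [set: 'I_n.+1] -> cells (F w J)),
      (forall X, cells X ->
         exists! wJ : (V -> V) * set 'I_n.+1,
           [/\ W wJ.1, wJ.2 `<` [set: 'I_n.+1], Des wJ.1 `&` wJ.2 = set0 &
               X = F wJ.1 wJ.2]),
      (forall w, W w ->
         [/\ maximal_cell cells cell_le (F w set0),
             (forall X,
                [/\ cells X, cell_le X (F w set0) & colors X = Des w] <->
                X = F w (~` Des w)) &
             (forall X,
                (exists J : set 'I_n.+1,
                   [/\ J `<` [set: 'I_n.+1], Des w `&` J = set0 &
                       X = F w J]) <->
                [/\ cells X, cell_le X (F w set0) &
                    cell_le (F w (~` Des w)) X])]) &
      partitionable cells cell_le].

Proof.
move=> W Des F cells colors.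
have Hu := descent_free_unique Phi_root alpha_simple theta_highest ip_norm.
split.
- exact: torus_cell_cells Phi_root alpha_simple theta_highest.
- move=> X /(cell_descent_free Phi_root alpha_simple theta_highest ip_norm).
  move=> [w [J [wW JT DJ XE]]]; exists (w, J); split=> // -[w' J'].
  move=> [/= w'W J'T DJ' XE'].
  by have [|-> ->] := Hu w J w' J' wW w'W JT DJ DJ'; first by rewrite -XE.
- move=> w wW.
  have DT := descents_proper Phi_root alpha_simple theta_highest wW.
  have T0 := @set0_proper n.
  have colE :=
    color_set_torus_cell Phi_root alpha_simple theta_highest ip_norm wW.
  split.
  + exact: maximal_torus_cell.
  + move=> X; split=> [[cX X0 colX]|->].
      (* A face of F(w, 0) is some F(w, K), and its color set determines K. *)
      have [K [KT _ XE]] := cell_le_torus_cellP Phi_root alpha_simple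
        theta_highest ip_norm wW T0 cX X0.
      by rewrite XE -[Des w]colX XE [colors _]colE// setCK.
    split; first exact: (torus_cell_cells Phi_root alpha_simple theta_highest).
      exact: (cell_le_torus_cell Phi_root alpha_simple theta_highest).
    by rewrite [LHS]colE// setCK.
  + by move=> X; apply: interval_torus_cell.
- exact: partitionable_torus theta_highest ip_norm.
Qed.
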